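(* The theory $T^*_{\mathrm{feq}}$ does not have $SOP_1$.
   Context: Notation: ${}^{\omega>}2$ is the set of finite sequences of $0$'s and $1$'s, ${}^{\omega}2$ the set of infinite such sequences; $\nu\frown\langle i\rangle$ is concatenation; $\nu\trianglelefteq\eta$ means $\nu$ is an initial segment of $\eta$ (possibly equal); $\rho\restriction n$ is the initial segment of length $n$. For a complete first order theory $T$, $\mathfrak C$ denotes its monster model (a $\kappa^*$-saturated and homogeneous model for a big enough $\kappa^*$). $T_{\mathrm{feq}}$ is the following theory in the language $\{Q,P,E,R,F\}$: (a) $P$ and $Q$ are unary predicates which are disjoint, and $(\forall x)[P(x)\vee Q(x)]$; (b) $E$ is an equivalence relation on $Q$; (c) $R$ is a binary relation on $Q\times P$ such that $[x\,R\,z \;\&\; y\,R\,z\;\&\; x\,E\,y]\Rightarrow x=y$ (so $R$ picks for each $z\in P$ at most one representative of any $E$-equivalence class); (d) $F$ is a (partial) binary function from $Q\times P$ to $Q$ which satisfies $F(x,z)\in Q\;\&\;F(x,z)\,R\,z\;\&\;x\,E\,F(x,z)$ (so for $x\in Q$, $z\in P$, $F$ picks the representative of the $E$-class of $x$ which is in the relation $R$ with $z$). $T^*_{\mathrm{feq}}$ is the model completion of $T_{\mathrm{feq}}$ (a complete theory with infinite models, in which $F$ is a full function on $Q\times P$). A complete theory $T$ has $SOP_1$ if there is a formula $\varphi(\bar x,\bar y)$ which exemplifies this in $\mathfrak C$, meaning: there are $\bar a_\eta\in\mathfrak C$ for $\eta\in{}^{\omega>}2$ such that (a) for every $\rho\in{}^\omega2$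 the set $\{\varphi(\bar x,\bar a_{\rho\restriction n}):n<\omega\}$ is consistent; (b) if $\nu\frown\langle0\rangle\trianglelefteq\eta\in{}^{\omega>}2$, then $\{\varphi(\bar x,\bar a_\eta),\varphi(\bar x,\bar a_{\nu\frown\langle1\rangle})\}$ is inconsistent. *)

(* Defs.v *)
From Stdlib Require List.
From mathcomp Require Import all_boot.
From mathcomp Require Import boolp classical_sets functions cardinality.

Set Implicit Arguments.
Unset Strict Implicit.
Unset Printing Implicit Defensive.

Local Open Scope classical_set_scope.
Local Open Scope card_scope.

Record language := Language { symb :> Type; arity : symb -> nat }.

Record structure (L : language) := Structure {
  carrier :> Type;
  carrier_inhabited : inhabited carrier;
  interp : forall s : L, (arity s).-tuple carrier -> Prop }.

(* [formula L V] is the type of first order formulas (with equality) whose free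
   variables are taken in [V]; under a quantifier, [None] is the variable bound
   by it. A formula over a set of parameters [A] in the variables [V] is an
   element of [formula L (V + A)]. *)
Inductive formula (L : language) (V : Type) : Type :=
| Bot
| Eq (x y : V)
| Rel (s : L) (a : (arity s).-tuple V)
| Imp (p q : formula L V)
| All (p : formula L (option V)).

Arguments Bot {L V}.
Arguments Eq {L V}.
Arguments Rel {L V}.
Arguments Imp {L V}.
Arguments All {L V}.

Declare Scope fo_scope.
Delimit Scope fo_scope with fo.
Bind Scope fo_scope with formula.

Definition Not L V (p : formula L V) : formula L V := Imp p Bot.
Definition Or L V (p q : formula L V) : formula L V := Imp (Not p) q.
Definition And L V (p q : formula L V) : formula L V := Not (Imp p (Not q)).
Definition Ex L V (p : formula L (option V)) : formula L V := Not (All (Not p)).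

Notation "`~ p" := (Not p) (at level 35, right associativity) : fo_scope.
Notation "p `/\ q" := (And p q) (at level 80, right associativity) : fo_scope.
Notation "p `\/ q" := (Or p q) (at level 85, right associativity) : fo_scope.
Notation "p `=> q" := (Imp p q) (at level 90, right associativity) : fo_scope.

Fixpoint rename L V W (f : V -> W) (p : formula L V) : formula L W :=
  match p with
  | Bot => Bot
  | Eq x y => Eq (f x) (f y)
  | Rel s a => Rel s (map_tuple f a)
  | Imp p q => Imp (rename f p) (rename f q)
  | All p => All (rename (omap f) p)
  end.

Definition extend V C (e : V -> C) (c : C) : option V -> C :=
  fun v => if v is Some w then e w else c.

Definition join V W C (e : V -> C) (f : W -> C) : V + W -> C :=
  fun v => match v with inl x => e x | inr y => f y end.

Fixpoint holds L (M : structure L) V (e : V -> M) (p : formula L V) : Prop :=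
  match p with
  | Bot => False
  | Eq x y => e x = e y
  | Rel s a => interp (map_tuple e a)
  | Imp p q => holds e p -> holds e q
  | All p => forall c : M, holds (extend e c) p
  end.

Definition sentence L := formula L void.
Definition theory L := set (sentence L).

Definition models L (M : structure L) (T : theory L) : Prop :=
  forall p, T p -> holds (fun v : void => match v with end : M) p.

Definition embedding L (M N : structure L) (f : M -> N) : Prop :=
  injective f /\
  forall (s : L) (a : (arity s).-tuple M), interp (map_tuple f a) <-> interp a.

(* The expansions of [N] that are models of [T'] together with the quantifier
   free diagram of [M] are the pairs ([N], [f]) with [N] a model of [T'] and
   [f] an embedding of [M] into [N]. A sentence with parameters in [M] is an
   element of [formula L M], so the last clause says that [T'] together with the
   diagram of [M] is complete (it is consistent by the second one). *)
Definition model_completion L (T T' : theory L) : Prop :=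
  [/\ forall M : structure L, models M T' -> models M T,
      forall M : structure L, models M T ->
        exists (N : structure L) (f : M -> N), models N T' /\ embedding f
    & forall M N1 N2 : structure L,
        models M T -> models N1 T' -> models N2 T' ->
        forall (f1 : M -> N1) (f2 : M -> N2), embedding f1 -> embedding f2 ->
        forall p : formula L M, holds f1 p <-> holds f2 p].

Definition realized L (C : structure L) X A (par : A -> C)
    (p : set (formula L (X + A))) : Prop :=
  exists x : X -> C, forall phi, p phi -> holds (join x par) phi.

(* Consistency of a set of formulas with parameters from [C], in the sense of
   the elementary diagram of [C]. *)
Definition consistent L (C : structure L) X A (par : A -> C)
    (p : set (formula L (X + A))) : Prop :=
  forall q : set (formula L (X + A)), finite_set q -> q `<=` p -> realized par q.

(* A cardinal is given by a type [K] of that size. *)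
Definition small (K : Type) U (A : set U) : Prop := ~ ([set: K] #<= A).

Definition saturated (K : Type) L (C : structure L) : Prop :=
  forall A : set C, small K A ->
  forall p : set (formula L (unit + A)),
    consistent (fun a : A => set_val a) p -> realized (fun a : A => set_val a) p.

Definition elementary_on L (C : structure L) (A : set C) (f : A -> C) : Prop :=
  forall phi : formula L A, holds (fun a : A => set_val a) phi <-> holds f phi.

Definition homogeneous (K : Type) L (C : structure L) : Prop :=
  forall (A : set C) (f : A -> C), small K A -> elementary_on f ->
  forall c : C, exists d : C, forall phi : formula L (option A),
    holds (extend (fun a : A => set_val a) c) phi <-> holds (extend f d) phi.

(* The first clause is what "big enough" has to mean: K is larger than the
   number of formulas, so in particular uncountable. *)
Definition monster (K : Type) L (T : theory L) (C : structure L) : Prop :=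
  [/\ small K [set: formula L nat], models C T, saturated K C
    & homogeneous K C].

Section SOP1.
Variables (L : language) (C : structure L) (m n : nat).

(* phi(x, b), as a formula in x with parameters from C *)
Definition inst (phi : formula L ('I_m + 'I_n)) (b : 'I_n -> C) :
    formula L ('I_m + C) :=
  rename (fun v => match v with inl i => inl i | inr j => inr (b j) end) phi.

Definition exemplifies_SOP1 (phi : formula L ('I_m + 'I_n)) : Prop :=
  exists a : seq bool -> 'I_n -> C,
    (forall rho : nat -> bool,
       consistent id [set inst phi (a (mkseq rho k)) | k in [set: nat]]) /\
    (forall nu eta : seq bool, prefix (rcons nu false) eta ->
       ~ consistent id
           [set inst phi (a eta); inst phi (a (rcons nu true))]).
End SOP1.

Definition has_SOP1 L (T : theory L) : Prop :=
  exists (K : Type) (C : structure L), monster K T C /\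
  exists (m n : nat) (phi : formula L ('I_m + 'I_n)), exemplifies_SOP1 C phi.

(* The partial binary function F is represented by its graph:
   [feqF] x z y stands for F(x, z) = y. *)
Inductive feq_symb := feqQ | feqP | feqE | feqR | feqF.

Definition Lfeq : language :=
  Language (fun s => match s with
                     | feqQ | feqP => 1 | feqE | feqR => 2 | feqF => 3
                     end).

Section Tfeq.
Let fml V := formula Lfeq V.
Let Q V (x : V) : fml V := @Rel Lfeq V feqQ [tuple x].
Let P V (x : V) : fml V := @Rel Lfeq V feqP [tuple x].
Let E V (x y : V) : fml V := @Rel Lfeq V feqE [tuple x; y].
Let R V (x z : V) : fml V := @Rel Lfeq V feqR [tuple x; z].
Let F V (x z y : V) : fml V := @Rel Lfeq V feqF [tuple x; z; y].


Local Open Scope fo_scope.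

Definition PQ_disjoint : sentence Lfeq :=
  let x := None in All (`~ (P x `/\ Q x)).
Definition PQ_cover : sentence Lfeq :=
  let x := None in All (P x `\/ Q x).

Definition E_on_Q : sentence Lfeq :=
  let x := Some None in let y := None in
  All (All (E x y `=> Q x `/\ Q y)).
Definition E_refl : sentence Lfeq :=
  let x := None in All (Q x `=> E x x).
Definition E_sym : sentence Lfeq :=
  let x := Some None in let y := None in
  All (All (E x y `=> E y x)).
Definition E_trans : sentence Lfeq :=
  let x := Some (Some None) in let y := Some None in let z := None in
  All (All (All (E x y `/\ E y z `=> E x z))).

Definition R_on_QP : sentence Lfeq :=
  let x := Some None in let z := None in
  All (All (R x z `=> Q x `/\ P z)).
Definition R_uniq : sentence Lfeq :=
  let x := Some (Some None) in let y := Some None in let z := None in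
  All (All (All (R x z `/\ R y z `/\ E x y `=> Eq x y))).

Definition F_functional : sentence Lfeq :=
  let x := Some (Some (Some None)) in let z := Some (Some None) in
  let y := Some None in let y' := None in
  All (All (All (All (F x z y `/\ F x z y' `=> Eq y y')))).
Definition F_on_QP : sentence Lfeq :=
  let x := Some (Some None) in let z := Some None in let y := None in
  All (All (All (F x z y `=> Q x `/\ P z))).
Definition F_rep : sentence Lfeq :=
  let x := Some (Some None) in let z := Some None in let y := None in
  All (All (All (F x z y `=> Q y `/\ R y z `/\ E x y))).
Definition F_defined : sentence Lfeq :=
  let x := Some None in let z := None in
  All (All (Q x `/\ P z `=> Ex (F (Some x) (Some z) None))).
End Tfeq.

(* F is a partial function on the universe, with domain Q * P ([F_on_QP] and
   [F_defined]). T_feq has a model completion only if F is defined on all of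
   Q * P: if F(x, z) and F(x, w) could be undefined in M = {x, z, w}, then the
   representative for z of the class of x would be R-related to w in one
   extension of M and not in another, and no theory whose models contain these
   extensions would become complete by adding the diagram of M. *)
Definition Tfeq : theory Lfeq :=
  [set p | List.In p
    [:: PQ_disjoint; PQ_cover;
        E_on_Q; E_refl; E_sym; E_trans;
        R_on_QP; R_uniq;
        F_functional; F_on_QP; F_rep; F_defined]].

(* Main.v *)
From mathcomp Require Import all_boot.
From mathcomp Require Import boolp classical_sets functions cardinality.
Require Import Defs.

(* By pigeonhole and Ramsey's theorem, a tree witnessing SOP_1 contains tuples
   c_i = a_(u_i) along a branch and d_i = a_(v_i) off it, with phi(x, d_i) and
   phi(x, c_j) inconsistent for i < j, such that c_i and d_i look alike over
   the earlier c_k and the pattern of coincidences between c_i, d_i and c_j (as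
   elements and as E-classes) does not depend on i < j. It follows that c_i and
   d_i also look alike over c_j. If b realizes phi(x, c_i) for enough i, then
   for some i < j its elements lie in, or are E-equivalent to elements of, c_i
   if and only if they do so for c_j. A model of T_feq glued from two copies of
   the given one then contains a tuple that looks over c_j as b does and over
   d_i as b does over c_i, so phi(x, d_i) and phi(x, c_j) are consistent. *)

Set Implicit Arguments.
Unset Strict Implicit.
Unset Printing Implicit Defensive.

(** * First order formulas *)

Lemma eq_holds L (M : structure L) V (e e' : V -> M) (p : formula L V) :
  e =1 e' -> holds e p -> holds e' p.
Proof. by move=> /funext ->. Qed.

Lemma holds_rename L (M : structure L) V W (f : V -> W) (e : W -> M)
    (p : formula L V) :
  holds e (rename f p) <-> holds (e \o f) p.
Proof.
elim: p W f e => {V} [V|V x y|V s a|V p IHp q IHq|V p IHp] W f e //=.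
- suff -> : map_tuple e (map_tuple f a) = map_tuple (e \o f) a by [].
  by apply: val_inj; rewrite /= -map_comp.
- by rewrite IHp IHq.
- suff H c : holds (extend e c) (rename (omap f) p) <->
             holds (extend (e \o f) c) p by split=> h c; apply/H.
  by rewrite IHp; split; apply: eq_holds; case.
Qed.

(* These turn the unfolding of [holds] at And, Or and Ex into the connectives
   of Prop. *)
Lemma and_encE (p q : Prop) : ((p -> q -> False) -> False) <-> p /\ q.
Proof.
by split=> [h|[hp hq] /(_ hp hq)//]; split; apply: contrapT => n; apply: h.
Qed.

Lemma or_encE (p q : Prop) : ((p -> False) -> q) <-> p \/ q.
Proof.
split=> [h|[hp /(_ hp)//|//]].
by have [?|?] := pselect p; [left|right; apply: h].
Qed.

Lemma ex_encE A (P : A -> Prop) :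
  ((forall x, P x -> False) -> False) <-> exists x, P x.
Proof.
split=> [h|[c hc] /(_ c)//].
by apply: contrapT => n; apply: h => c hc; apply: n; exists c.
Qed.

(** Completeness over a diagram compares formulas whose free variables are all parameters, so the
    existence of a realizing tuple has to be one formula. Index [ord0] gets the outermost
    quantifier. *)
Lemma ex_tuple_formula L m V (p : formula L ('I_m + V)) :
  exists q : formula L V, forall (M : structure L) (e : V -> M),
    holds e q <-> exists x : 'I_m -> M, holds (join x e) p.
Proof.
elim: m V p => [|m IHm] V p.
  have no (A : Type) (i : 'I_0) : A by case: i.
  pose f (v : 'I_0 + V) := match v with inl i => no V i | inr y => y end.
  exists (rename f p) => M e; rewrite holds_rename.
  have fE x : e \o f =1 join x e by case=> // -[].
  split=> [h|[x hx]]; last by apply: eq_holds hx => v; rewrite (fE x).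
  by exists (no M); apply: eq_holds h; apply: fE.
pose f (v : 'I_m.+1 + V) : 'I_m + option V := match v with
  | inl i => if unlift ord0 i is Some k then inl k else inr None
  | inr y => inr (Some y)
  end.
have [q qP] := IHm _ (rename f p).
exists (Ex q) => M e; split; rewrite /= ex_encE.
- move=> [c /qP[x]]; rewrite holds_rename => hx.
  exists (fun i => if unlift ord0 i is Some k then x k else c).
  by apply: eq_holds hx => -[i|y] //=; case: unliftP.
- move=> [x hx]; exists (x ord0); apply/qP; exists (x \o lift ord0).
  rewrite holds_rename; apply: eq_holds hx => -[i|y] //=.
  by case: unliftP => [k|] ->.
Qed.

(** * Models of [Tfeq] as an equivalence relation with a function *)

(* The function g is F made total by g x z = x outside of Q * P, and Q is
   the domain of E; thus R x z means g x z = x on Q * P. *)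
Record feq_axioms (C : Type) (E : C -> C -> Prop) (g : C -> C -> C) : Prop := {
  feq_sym : forall x y, E x y -> E y x;
  feq_trans : forall x y z, E x y -> E y z -> E x z;
  feq_rep : forall x z, E x x -> ~ E z z -> E x (g x z);
  feq_class : forall x y z, E x y -> ~ E z z -> g x z = g y z;
  feq_out : forall x z, ~ (E x x /\ ~ E z z) -> g x z = x }.

(** The arguments form a sequence so that one match on its shape serves all symbols; the last case
    does not arise for tuples of the right arity. *)
Definition feq_interp C (E : C -> C -> Prop) (g : C -> C -> C) (s : feq_symb)
    (l : seq C) : Prop :=
  match s, l with
  | feqQ, [:: x] => E x x
  | feqP, [:: x] => ~ E x x
  | feqE, [:: x; y] => E x y
  | feqR, [:: x; z] => [/\ E x x, ~ E z z & g x z = x]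
  | feqF, [:: x; z; y] => [/\ E x x, ~ E z z & g x z = y]
  | _, _ => False
  end.

Definition feq_structure C (i : inhabited C) E g : structure Lfeq :=
  @Structure Lfeq C i (fun s a => feq_interp E g s (tval a)).

Definition presents (M : structure Lfeq) (E : M -> M -> Prop)
    (g : M -> M -> M) : Prop :=
  feq_axioms E g /\ forall (s : Lfeq) (a : (arity s).-tuple M),
    interp a <-> feq_interp E g s (tval a).

Lemma feq_structure_presents C (i : inhabited C) E g : feq_axioms E g ->
  presents (M := feq_structure i E g) E g.
Proof. by []. Qed.

Section FeqAxioms.
Variables (C : Type) (E : C -> C -> Prop) (g : C -> C -> C).
Hypothesis ax : feq_axioms E g.

Lemma feq_dom x y : E x y -> E x x /\ E y y.
Proof.
by move=> h; have h' := feq_sym ax h; split; apply: (feq_trans ax); eauto.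
Qed.

(** No element lies in both Q and P, so the default value applies. This puts the entries of a tuple
    among its terms [g x z]. *)
Lemma feq_diag x : g x x = x.
Proof. by apply: (feq_out ax); case. Qed.

Lemma feq_rep_iff x z y : E (g x z) y <-> E x y.
Proof.
have [[Qx Pz]|n] := pselect (E x x /\ ~ E z z); last by rewrite (feq_out ax).
have Exg := feq_rep ax Qx Pz.
by split; apply: (feq_trans ax) => //; apply: (feq_sym ax).
Qed.

(** F takes its values in Q, so a term in P can only be a default value. *)
Lemma feq_P_term x z : ~ E (g x z) (g x z) -> g x z = x.
Proof.
move=> n; apply: (feq_out ax) => -[Qx Pz]; apply: n.
by have [] := feq_dom (feq_rep ax Qx Pz).
Qed.

Lemma feq_idem x y z : E x x -> ~ E z z -> g (g x y) z = g x z.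
Proof.
by move=> Qx Pz; apply: (feq_class ax) => //; apply/feq_rep_iff.
Qed.

End FeqAxioms.

Lemma models_feq_structure C (i : inhabited C) E g : feq_axioms E g ->
  models (feq_structure i E g) Tfeq.
Proof.
move=> ax p; rewrite /Tfeq /=.
have dom x y : E x y -> E x x /\ E y y by apply: (feq_dom ax).
case=> [<-|[<-|[<-|[<-|[<-|[<-|[<-|[<-|[<-|[<-|[<-|[<-|//]]]]]]]]]]]] /=.
- by move=> x /and_encE [].
- by move=> x; apply/or_encE; have [] := pselect (E x x); [right|left].
- by move=> x y /dom h; apply/and_encE.
- by [].
- by move=> x y; apply: (feq_sym ax).
- by move=> x y z /and_encE[]; apply: (feq_trans ax).
- by move=> x y [? ? ?]; apply/and_encE.
- move=> x y z /and_encE[[_ Pz gx]] /and_encE[[_ _ gy] Exy].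
  by rewrite -gx -gy; apply: (feq_class ax).
- by move=> x z y y' /and_encE[[_ _ <-] [_ _ <-]].
- by move=> x z y [Qx Pz _]; apply/and_encE.
- move=> x z y [Qx Pz <-]; have Exg := feq_rep ax Qx Pz.
  have [_ Qg] := dom _ _ Exg.
  apply/and_encE; split=> //; apply/and_encE.
  by do 2!split=> //; apply: (feq_idem ax).
- by move=> x z /and_encE[Qx Pz]; apply/ex_encE; exists (g x z).
Qed.

Lemma models_presents (M : structure Lfeq) : models M Tfeq ->
  exists E g, @presents M E g.
Proof.
move=> hM.
have m1 V (e : V -> M) x : map_tuple e [tuple x] = [tuple e x].
  exact: val_inj.
have m2 V (e : V -> M) x y : map_tuple e [tuple x; y] = [tuple e x; e y].
  exact: val_inj.
have m3 V (e : V -> M) x y z :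
  map_tuple e [tuple x; y; z] = [tuple e x; e y; e z] by exact: val_inj.
pose Q x := @interp Lfeq M feqQ [tuple x].
pose P x := @interp Lfeq M feqP [tuple x].
pose E x y := @interp Lfeq M feqE [tuple x; y].
pose R x y := @interp Lfeq M feqR [tuple x; y].
pose F x y z := @interp Lfeq M feqF [tuple x; y; z].
have ax p : List.In p
    [:: PQ_disjoint; PQ_cover; E_on_Q; E_refl; E_sym; E_trans; R_on_QP;
        R_uniq; F_functional; F_on_QP; F_rep; F_defined] ->
    holds (fun v : void => match v with end : M) p by apply: hM.
have disj x : P x -> Q x -> False.
  have /(_ x) := ax PQ_disjoint ltac:(rewrite /=; tauto).
  by rewrite /= !m1 => /and_encE h p q; apply: h.
have cover x : P x \/ Q x.
  have /(_ x) := ax PQ_cover ltac:(rewrite /=; tauto).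
  by rewrite /= !m1 or_encE.
have E_Q x y : E x y -> Q x /\ Q y.
  have /(_ x y) := ax E_on_Q ltac:(rewrite /=; tauto).
  by rewrite /= !m2 !m1 and_encE.
have Erefl x : Q x -> E x x.
  have /(_ x) := ax E_refl ltac:(rewrite /=; tauto).
  by rewrite /= !m1 !m2.
have Esym x y : E x y -> E y x.
  have /(_ x y) := ax E_sym ltac:(rewrite /=; tauto).
  by rewrite /= !m2.
have Etrans x y z : E x y -> E y z -> E x z.
  have /(_ x y z) := ax E_trans ltac:(rewrite /=; tauto).
  by rewrite /= !m2; tauto.
have R_QP x z : R x z -> Q x /\ P z.
  have /(_ x z) := ax R_on_QP ltac:(rewrite /=; tauto).
  by rewrite /= !m2 !m1 and_encE.
have Runiq x y z : R x z -> R y z -> E x y -> x = y.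
  have /(_ x y z) := ax R_uniq ltac:(rewrite /=; tauto).
  by rewrite /= !m2 => h *; apply: h; tauto.
have Ffun x z y y' : F x z y -> F x z y' -> y = y'.
  have /(_ x z y y') := ax F_functional ltac:(rewrite /=; tauto).
  by rewrite /= !m3 => h *; apply: h; tauto.
have F_QP x z y : F x z y -> Q x /\ P z.
  have /(_ x z y) := ax F_on_QP ltac:(rewrite /=; tauto).
  by rewrite /= !m3 !m1 and_encE.
have Frep x z y : F x z y -> R y z /\ E x y.
  have /(_ x z y) := ax F_rep ltac:(rewrite /=; tauto).
  by rewrite /= !m3 !m2 !m1 !and_encE; tauto.
have Fdef x z : Q x -> P z -> exists y, F x z y.
  have /(_ x z) := ax F_defined ltac:(rewrite /=; tauto).
  rewrite /= !m1 => h q p; have /ex_encE[y] := h ((and_encE _ _).2 (conj q p)).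
  by rewrite m3; exists y.
have QE x : E x x <-> Q x by split; [case/E_Q|apply: Erefl].
have PE x : ~ E x x <-> P x.
  rewrite QE; split; first by case: (cover x).
  by move=> p q; apply: disj p q.
have [g gP] : exists g : M -> M -> M, forall x z,
    (E x x /\ ~ E z z -> F x z (g x z)) /\ (~ (E x x /\ ~ E z z) -> g x z = x).
  have /choice[g gP] : forall xz : M * M, exists y,
    (E xz.1 xz.1 /\ ~ E xz.2 xz.2 -> F xz.1 xz.2 y) /\
    (~ (E xz.1 xz.1 /\ ~ E xz.2 xz.2) -> y = xz.1).
    move=> [x z] /=; have [h|n] := pselect (E x x /\ ~ E z z).
      have [/QE qx /PE pz] := h; have [y Fy] := Fdef _ _ qx pz.
      by exists y.
    by exists x.
  by exists (fun x z => g (x, z)) => x z; apply: (gP (x, z)).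
have gF x z : E x x -> ~ E z z -> F x z (g x z).
  by move=> ? ?; apply: (gP x z).1.
exists E, g; split.
  split=> //.
  - by move=> x z qx pz; have [] := Frep _ _ _ (gF x z qx pz).
  - move=> x y z exy pz; have [qx qy] := E_Q _ _ exy.
    have [rx ex] := Frep _ _ _ (gF x z (Erefl _ qx) pz).
    have [ry ey] := Frep _ _ _ (gF y z (Erefl _ qy) pz).
    apply: (Runiq _ _ _ rx ry); apply: (Etrans _ y) ey.
    by apply: (Etrans _ x); first apply: Esym.
  - by move=> x z; apply: (gP x z).2.
case=> a.
- have [x ->] : exists x, a = [tuple x].
    by case: a => -[|x []] // h; exists x; apply: val_inj.
  by rewrite /= QE.
- have [x ->] : exists x, a = [tuple x].
    by case: a => -[|x []] // h; exists x; apply: val_inj.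
  by rewrite /= PE.
- have [x [y ->]] : exists x y, a = [tuple x; y].
    by case: a => -[|x [|y []]] // h; exists x, y; apply: val_inj.
  by [].
- have [x [z ->]] : exists x z, a = [tuple x; z].
    by case: a => -[|x [|z []]] // h; exists x, z; apply: val_inj.
  split=> /= [rxz|[qx pz xE]]; last first.
    by have [] := Frep _ _ _ (gF x z qx pz); rewrite xE.
  have [/QE qx /PE pz] := R_QP _ _ rxz; split=> //.
  have [rg eg] := Frep _ _ _ (gF x z qx pz).
  by apply: (Runiq _ _ z) => //; apply: Esym.
- have [x [z [y ->]]] : exists x z y, a = [tuple x; z; y].
    by case: a => -[|x [|z [|y []]]] // h; exists x, z, y; apply: val_inj.
  split=> /= [fxzy|[qx pz <-]]; last exact: gF.
  have [/QE qx /PE pz] := F_QP _ _ _ fxzy; split=> //.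
  by apply: Ffun fxzy; apply: gF.
Qed.

(** * Embeddings and quantifier elimination *)

Lemma feq_embedding (M N : structure Lfeq) E g E' g' (f : M -> N) :
  @presents M E g -> @presents N E' g' -> injective f ->
  (forall x y, E' (f x) (f y) <-> E x y) ->
  (forall x z, f (g x z) = g' (f x) (f z)) -> embedding f.
Proof.
move=> [_ hM] [_ hN] f_inj fE fg; split=> // s a.
have {}fE x y : E' (f x) (f y) = E x y by apply/propext.
rewrite hM hN; case: s a => -[l /= _] /=; do ?[case: l => [|? l] //=];
  rewrite ?fE // -?fg.
- by split=> -[? ? h]; split=> //; [apply: f_inj|rewrite h].
- by split=> -[? ? h]; split=> //; [apply: f_inj|rewrite h].
Qed.

Lemma embedding_feq (M N : structure Lfeq) E g E' g' (f : M -> N) :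
  @presents M E g -> @presents N E' g' -> embedding f ->
  [/\ injective f, forall x y, E' (f x) (f y) <-> E x y
    & forall x z, f (g x z) = g' (f x) (f z)].
Proof.
move=> [axM hM] [axN hN] [f_inj fI].
have fE x y : E' (f x) (f y) <-> E x y.
  by have := fI feqE [tuple x; y]; rewrite hM hN.
split=> // x z.
have [[Qx Pz]|n] := pselect (E x x /\ ~ E z z).
  have := fI feqF [tuple x; z; g x z]; rewrite hM hN /= => -[_].
  by case=> [|_ _ <-].
rewrite (feq_out axM) // (feq_out axN) // => -[/fE Qx Pz]; apply: n.
by split=> // /fE.
Qed.

(** The substructure generated by [e] embeds in [N1] by inclusion and in [N2] by [f], and [T] is
    complete over its diagram. Hence [f] has to respect F only on the entries of [e]. *)
Lemma holds_partial_iso (T : theory Lfeq) (hT : model_completion Tfeq T)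
    (N1 N2 : structure Lfeq) E1 g1 E2 g2 (I : Type) (i0 : I) (e : I -> N1)
    (f : N1 -> N2) :
  models N1 T -> models N2 T -> @presents N1 E1 g1 -> @presents N2 E2 g2 ->
  injective f -> (forall x y, E2 (f x) (f y) <-> E1 x y) ->
  (forall i j, f (g1 (e i) (e j)) = g2 (f (e i)) (f (e j))) ->
  forall p : formula Lfeq I, holds e p <-> holds (f \o e) p.
Proof.
move=> hN1 hN2 pN1 pN2 f_inj fE fg p.
have [ax1 _] := pN1; have [ax2 _] := pN2.
(* Terms of depth one are closed under [g1]: a term in P is an entry of [e], and F depends on its
   first argument only through the class, which is the class of an entry. *)
pose cl x := exists i j, x = g1 (e i) (e j).
have cl_e i : cl (e i) by exists i, i; rewrite (feq_diag ax1).
have clg x z : cl x -> cl z -> cl (g1 x z) /\ f (g1 x z) = g2 (f x) (f z).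
  move=> clx clz; have [[Qx Pz]|n] := pselect (E1 x x /\ ~ E1 z z); last first.
    rewrite (feq_out ax1) // (feq_out ax2) // => -[/fE Qx Pz]; apply: n.
    by split=> // /fE.
  have [i [j xE]] := clx; have [k [l zE]] := clz.
  have {}zE : z = e k by rewrite zE (feq_P_term ax1) // -zE.
  have xi : E1 x (e i).
    by apply/(feq_sym ax1)/(feq_rep_iff ax1 _ (e j)); rewrite -xE.
  split; first by exists i, k; rewrite (feq_class ax1 xi) // zE.
  rewrite (feq_class ax1 xi) // zE fg (feq_class ax2 (x := f x) (y := f (e i))) //.
    exact/fE.
  by rewrite -zE => /fE.
pose M := {x | cl x}.
have sval_inj (x y : M) : sval x = sval y -> x = y.
  by apply: eq_sig_hprop => *; apply: Prop_irrelevance.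
pose E (x y : M) := E1 (sval x) (sval y).
pose g (x z : M) : M := exist _ _ (clg _ _ (svalP x) (svalP z)).1.
have axM : feq_axioms E g.
  split; rewrite /E /g.
  - by move=> x y; apply: (feq_sym ax1).
  - by move=> x y z; apply: (feq_trans ax1).
  - by move=> x z; apply: (feq_rep ax1).
  - by move=> x y z exy pz; apply: eq_exist; apply: (feq_class ax1).
  - by move=> [x cx] z n; apply: eq_exist; apply: (feq_out ax1).
have pM := feq_structure_presents (inhabits (exist cl _ (cl_e i0) : M)) axM.
set S := feq_structure _ _ _ in pM.
have S1 : @embedding _ S N1 sval.
  by apply: (feq_embedding pM pN1) => // x y; apply: sval_inj.
have S2 : @embedding _ S N2 (f \o sval).
  apply: (feq_embedding pM pN2) => /=.
  - by move=> x y /f_inj; apply: sval_inj.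
  - by move=> x y; apply: fE.
  - by move=> x z; apply: (clg _ _ (svalP x) (svalP z)).2.
have [_ _ /(_ S N1 N2 _ hN1 hN2 _ _ S1 S2)] := hT.
move=> /(_ (models_feq_structure _ axM)).
move=> /(_ (rename (fun i => exist cl _ (cl_e i)) p)).
by rewrite !holds_rename.
Qed.

(** * Gluing two copies of a model *)

Definition choose_or A (x0 : A) (P : A -> Prop) : A :=
  if pselect (exists x, P x) is left h then sval (cid h) else x0.

Lemma choose_orP A (x0 : A) (P : A -> Prop) :
  (exists x, P x) -> P (choose_or x0 P).
Proof. by rewrite /choose_or; case: pselect => // h _; apply: svalP. Qed.

Lemma choose_or_default A (x0 : A) (P : A -> Prop) :
  ~ (exists x, P x) -> choose_or x0 P = x0.
Proof. by rewrite /choose_or; case: pselect. Qed.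

Section Amalgam.
Variables (C : Type) (E : C -> C -> Prop) (g : C -> C -> C).
Hypothesis ax : feq_axioms E g.
Variable H : C -> C -> Prop.
Hypothesis H_eq : forall x x' y y', H x x' -> H y y' -> x = y <-> x' = y'.
Hypothesis H_E : forall x x' y y', H x x' -> H y y' -> E x y <-> E x' y'.

(* Two copies of C, in which the E-classes of the second copy that meet the
   domain of H are glued to the classes of their images in the first one;
   [copy] is the second copy, with y replaced by y' when H y y'. The elements
   [inr y] with y in the domain of H are then superfluous but harmless. *)
Definition copy (y : C) : C + C :=
  if `[< exists y', H y y' >] then inl (choose_or y (H y))
  else inr y.

Definition glued (x y : C) := exists u v, [/\ H u v, E u y & E v x].

Definition amalgam_E (x y : C + C) : Prop :=
  match x, y with
  | inl x, inl y | inr x, inr y => E x y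
  | inl x, inr y | inr y, inl x => glued x y
  end.

(** If the class of the first argument meets the copy that contains the second argument, the value
    is taken in that copy. Otherwise any choice that depends only on the class would satisfy the
    axioms. For [inr y] and an image [p] of [q] under [H], the choice [g y q] makes [copy] respect
    F; in the remaining cases [p] is simply read in the other copy. *)
Definition amalgam_raw (x z : C + C) : C + C :=
  match x, z with
  | inl x, inl p => inl (g x p)
  | inr y, inl p =>
      if `[< exists x, glued x y >] then inl (g (choose_or y (glued^~ y)) p)
      else inr (g y (choose_or p (H^~ p)))
  | inr y, inr p => copy (g y p)
  | inl x, inr p =>
      if `[< exists y, glued x y >] then copy (g (choose_or x (glued x)) p)
      else inl (g x p)
  end.

Definition amalgam_g (x z : C + C) : C + C :=
  if `[< amalgam_E x x /\ ~ amalgam_E z z >] then amalgam_raw x z else x.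

Arguments amalgam_E : simpl nomatch.
Arguments amalgam_raw : simpl nomatch.

Lemma copy_in y y' : H y y' -> copy y = inl y'.
Proof.
move=> h; rewrite /copy; case: asboolP => [ex|]; last by case; exists y'.
congr inl; have /= h' := choose_orP y ex.
by apply/(H_eq h' h).
Qed.

Lemma copy_out y : ~ (exists y', H y y') -> copy y = inr y.
Proof. by rewrite /copy => n; case: asboolP. Qed.

Lemma glued_uniq_l x x' y : glued x y -> glued x' y -> E x x'.
Proof.
move=> [u [v [h uy vx]]] [u' [v' [h' uy' vx']]].
apply: (feq_trans ax (feq_sym ax vx)); apply: (feq_trans ax) vx'.
by apply/(H_E h h'); apply: (feq_trans ax uy); apply: (feq_sym ax).
Qed.

Lemma glued_uniq_r x y y' : glued x y -> glued x y' -> E y y'.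
Proof.
move=> [u [v [h uy vx]]] [u' [v' [h' uy' vx']]].
apply: (feq_trans ax (feq_sym ax uy)); apply: (feq_trans ax) uy'.
by apply/(H_E h h'); apply: (feq_trans ax vx); apply: (feq_sym ax).
Qed.

Lemma glued_l x x' y : E x x' -> glued x y -> glued x' y.
Proof.
by move=> e [u [v [h uy vx]]]; exists u, v; split=> //; apply: (feq_trans ax) e.
Qed.

Lemma glued_r x y y' : E y y' -> glued x y -> glued x y'.
Proof.
by move=> e [u [v [h uy vx]]]; exists u, v; split=> //; apply: (feq_trans ax) e.
Qed.

Lemma amalgam_E_sym x y : amalgam_E x y -> amalgam_E y x.
Proof. by case: x y => [x|x] [y|y] //=; apply: (feq_sym ax). Qed.

Lemma amalgam_E_trans x y z : amalgam_E x y -> amalgam_E y z -> amalgam_E x z.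
Proof.
case: x y z => [x|x] [y|y] [z|z] //=; try exact: (feq_trans ax).
- by move=> /(feq_sym ax); apply: glued_l.
- exact: glued_uniq_l.
- by move=> h e; apply: glued_r e h.
- by move=> h e; apply: glued_l e h.
- exact: glued_uniq_r.
- by move=> /(feq_sym ax); apply: glued_r.
Qed.

Lemma copy_Er y w : amalgam_E (inr w) (copy y) <-> E w y.
Proof.
have [[y' h]|n] := pselect (exists y', H y y'); last by rewrite copy_out.
rewrite (copy_in h) /=; split.
  move=> [u [v [h' uw vy]]]; have /(H_E h' h) uy := vy.
  by apply: (feq_trans ax) uy; apply: (feq_sym ax).
move=> wy; exists y, y'; split=> //; first exact: (feq_sym ax).
have Qy := (feq_dom ax wy).2.
by apply/(H_E h h).
Qed.

Lemma copy_E x y : amalgam_E (copy x) (copy y) <-> E x y.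
Proof.
have [[x' h]|n] := pselect (exists x', H x x'); last first.
  by rewrite (copy_out n) copy_Er.
have [[y' h']|n'] := pselect (exists y', H y y').
  by rewrite (copy_in h) (copy_in h') /=; rewrite (H_E h h').
rewrite (copy_out n'); split; first by move=> /amalgam_E_sym/copy_Er/(feq_sym ax).
by move=> /(feq_sym ax)/copy_Er/amalgam_E_sym.
Qed.

Lemma copy_inj : injective copy.
Proof.
move=> x y.
have [[x' h]|n] := pselect (exists x', H x x');
  have [[y' h']|n'] := pselect (exists y', H y y').
- by rewrite (copy_in h) (copy_in h') => -[/(H_eq h h')].
- by rewrite (copy_in h) (copy_out n').
- by rewrite (copy_out n) (copy_in h').
- by rewrite (copy_out n) (copy_out n') => -[].
Qed.

Lemma amalgam_raw_rep x z :
  amalgam_E x x -> ~ amalgam_E z z -> amalgam_E x (amalgam_raw x z).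
Proof.
case: x z => [x|y] [p|p] Qx Pp; rewrite /amalgam_raw.
- exact: (feq_rep ax).
- case: asboolP => [ex|_]; last exact: (feq_rep ax).
  have /= := choose_orP x ex.
  move: (choose_or _ _) => y gl; apply: (@amalgam_E_trans _ (inr y)) => //.
  apply/copy_Er; apply: (feq_rep ax) => //.
  exact: (glued_uniq_r gl gl).
- case: asboolP => [ex|_].
    have /= := choose_orP y ex.
    move: (choose_or _ _) => x gl; apply: (@glued_l x) => //.
    by apply: (feq_rep ax) => //; apply: (glued_uniq_l gl gl).
  (* Whether or not [p] is an image under [H], the element that replaces it lies in P. *)
  apply: (feq_rep ax) => //; have [ex|?] := pselect (exists q, H q p);
    last by rewrite choose_or_default.
  by have /= h := choose_orP p ex; rewrite (H_E h h).
- by apply/copy_Er; apply: (feq_rep ax).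
Qed.

Lemma amalgam_raw_class x y z :
  amalgam_E x y -> ~ amalgam_E z z -> amalgam_raw x z = amalgam_raw y z.
Proof.
(* On glued classes the value does not depend on the elements chosen by [choose_or]. *)
have K1 a b p : ~ E p p -> glued a b ->
    amalgam_raw (inr b) (inl p) = inl (g a p) /\
    amalgam_raw (inl a) (inr p) = copy (g b p).
  move=> Pp gl; rewrite /amalgam_raw; split.
    case: asboolP => [ex|]; last by case; exists a.
    have /= gl' := choose_orP b ex.
    by congr inl; apply: (feq_class ax) => //; apply: glued_uniq_l gl' gl.
  case: asboolP => [ex|]; last by case; exists b.
  have /= gl' := choose_orP a ex.
  by congr copy; apply: (feq_class ax) => //; apply: glued_uniq_r gl' gl.
case: x y => [x|x] [y|y] /=; case: z => [p|p] e Pp.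
- by congr inl; apply: (feq_class ax).
- have [[b gl]|n] := pselect (exists b, glued x b).
    have [_ ->] := K1 _ _ _ Pp gl.
    by have [_ ->] := K1 _ _ _ Pp (glued_l e gl).
  rewrite /amalgam_raw; case: asboolP => // _; case: asboolP => [[b gl]|_].
    by case: n; exists b; apply: glued_l gl; apply: (feq_sym ax).
  by congr inl; apply: (feq_class ax).
- by have [-> _] := K1 _ _ _ Pp e.
- by have [_ ->] := K1 _ _ _ Pp e.
- by have [-> _] := K1 _ _ _ Pp e.
- by have [_ ->] := K1 _ _ _ Pp e.
- have [[b gl]|n] := pselect (exists b, glued b x).
    have [-> _] := K1 _ _ _ Pp gl.
    by have [-> _] := K1 _ _ _ Pp (glued_r e gl).
  rewrite /amalgam_raw; case: asboolP => // _; case: asboolP => [[b gl]|_].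
    by case: n; exists b; apply: glued_r gl; apply: (feq_sym ax).
  congr inr; apply: (feq_class ax) => //; have [ex|?] := pselect (exists q, H q p);
    last by rewrite choose_or_default.
  by have /= h := choose_orP p ex; rewrite (H_E h h).
- by congr copy; apply: (feq_class ax).
Qed.

Lemma amalgam_g_in x z :
  amalgam_E x x -> ~ amalgam_E z z -> amalgam_g x z = amalgam_raw x z.
Proof. by move=> ? ?; rewrite /amalgam_g; case: asboolP => // -[]. Qed.

Lemma amalgam_g_out x z :
  ~ (amalgam_E x x /\ ~ amalgam_E z z) -> amalgam_g x z = x.
Proof. by rewrite /amalgam_g => ?; case: asboolP. Qed.

Lemma amalgam_axioms : feq_axioms amalgam_E amalgam_g.
Proof.
split.
- exact: amalgam_E_sym.
- exact: amalgam_E_trans.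
- by move=> x z Qx Pz; rewrite amalgam_g_in //; apply: amalgam_raw_rep.
- move=> x y z e Pz; have e' := amalgam_E_sym e.
  rewrite !amalgam_g_in //; first exact: amalgam_raw_class.
    exact: amalgam_E_trans e.
  exact: amalgam_E_trans e'.
- exact: amalgam_g_out.
Qed.

(** The only obstruction arises when [p] is identified with some [p'] and the class of [y] is glued
    to that of [v]: the first copy then prescribes the value [g v p'], so [H] must send [g y p] to
    it. *)
Lemma copy_g y p :
  ((exists p', H p p') -> (exists x, glued x y) ->
   exists u v p', [/\ H u v, E u y, H p p' & H (g y p) (g v p')]) ->
  copy (g y p) = amalgam_g (copy y) (copy p).
Proof.
move=> hyp.
have [[Qy Pp]|n] := pselect (E y y /\ ~ E p p); last first.
  by rewrite (feq_out ax) // amalgam_g_out // !copy_E.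
rewrite amalgam_g_in ?copy_E //.
have Ey : amalgam_E (inr y) (copy y) by apply/copy_Er.
have Pip : ~ amalgam_E (copy p) (copy p) by move/copy_E.
rewrite -(amalgam_raw_class Ey) //.
have [[p' hp]|n] := pselect (exists p', H p p'); last by rewrite (copy_out n).
have Pp' : ~ E p' p' by rewrite -(H_E hp hp).
rewrite (copy_in hp).
have [gl|n] := pselect (exists x, glued x y).
  have [u [v [q [huv uy hq hg]]]] := hyp (ex_intro _ _ hp) gl.
  have <- : q = p' by apply/(H_eq hq hp).
  have Pq : ~ E q q by rewrite -(H_E hq hq).
  have gv : amalgam_E (inr y) (inl v).
    exists u, v; split=> //; apply/(H_E huv huv).
    exact: (feq_dom ax uy).1.
  by rewrite (copy_in hg) (amalgam_raw_class gv).
rewrite /amalgam_raw; case: asboolP => // _.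
have -> : choose_or p' (H^~ p') = p.
  have /= hq := choose_orP p' (ex_intro (H^~ p') p hp).
  by apply/(H_eq hq hp).
(* If [g y p] were in the domain of [H], the class of [y] would be glued. *)
apply: copy_out => -[w hw]; apply: n; exists w.
exists (g y p), w; split=> //; first exact/(feq_rep_iff ax).
apply/(H_E hw hw); apply/(feq_rep_iff ax)/(feq_sym ax).
by apply/(feq_rep_iff ax).
Qed.

(** The first copy is a substructure. The second keeps equality and E everywhere but F only under a
    condition, which suffices for [holds_partial_iso]. *)
Lemma amalgam : exists (E' : C + C -> C + C -> Prop) g' (i : C -> C + C),
  [/\ feq_axioms E' g',
      forall x y, E' (inl x) (inl y) <-> E x y,
      forall x z, inl (g x z) = g' (inl x) (inl z),
      injective i /\ forall x y, E' (i x) (i y) <-> E x y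
    & (forall y y', H y y' -> i y = inl y') /\
      forall y p,
        ((exists p', H p p') -> (exists u v, H u v /\ E u y) ->
         exists u v p', [/\ H u v, E u y, H p p' & H (g y p) (g v p')]) ->
        i (g y p) = g' (i y) (i p)].
Proof.
exists amalgam_E, amalgam_g, copy; split.
- exact: amalgam_axioms.
- by [].
- move=> x z; have [[Qx Pz]|n] := pselect (E x x /\ ~ E z z).
    by rewrite amalgam_g_in.
  by rewrite amalgam_g_out // (feq_out ax).
- by split; [apply: copy_inj|apply: copy_E].
- split; first exact: copy_in.
  move=> y p hyp; apply: copy_g => ex [x [u [v [h uy _]]]]; apply: hyp => //.
  by exists u, v.
Qed.
End Amalgam.

(** * Pigeonhole, Ramsey's theorem and indiscernibility in the tree *)

Lemma pigeonhole (K : finType) (f : nat -> K) :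
  exists i j, [/\ i < j, j <= #|K| & f i = f j].
Proof.
pose h (i : 'I_#|K|.+1) := f i.
have /injectivePn[i [j ne hij]] : ~~ injectiveb h.
  by apply/negP => /injectiveP/leq_card; rewrite card_ord ltnn.
have le (k : 'I_#|K|.+1) : k <= #|K| by rewrite -ltnS.
have [lt|lt|/val_inj eq] := ltngtP i j; last by rewrite eq eqxx in ne.
- by exists i, j.
- by exists j, i.
Qed.

Definition unbounded (A : nat -> Prop) := forall n, exists2 x, n <= x & A x.

Lemma unbounded_pigeonhole (K : finType) (f : nat -> K) A : unbounded A ->
  exists k, unbounded (fun x => A x /\ f x = k).
Proof.
move=> uA; apply: contrapT => no.
have /choice[b bP] k : exists n, forall x, n <= x -> A x -> f x <> k.
  apply: contrapT => no'; apply: no; exists k => n; apply: contrapT => no.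
  by apply: no'; exists n => x nx Ax fx; apply: no; exists x.
have [x bx Ax] := uA (\max_k b k).
by apply: bP Ax (erefl (f x)); apply: leq_trans bx; apply: leq_bigmax.
Qed.

Lemma unbounded_enum A : unbounded A ->
  exists f : nat -> nat, (forall i j, i < j -> f i < f j) /\ forall i, A (f i).
Proof.
move=> uA; have /choice[s sP] n : exists x, n <= x /\ A x.
  by have [x nx Ax] := uA n; exists x.
pose f i := iter i.+1 (fun x => s x.+1) 0.
exists f; split=> [|i]; last exact: (sP _).2.
apply: (@homo_ltn _ f (fun x y => x < y)) => [? ? ?|k]; first exact: ltn_trans.
exact: (sP _).1.
Qed.

(** Each step picks a point of the current unbounded set and thins the set until that point has one
    colour with all the rest. Colours then depend on the smaller index only, and a last pigeonhole
    makes them constant. *)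
Lemma ramsey_pairs (K : finType) (col : nat -> nat -> K) :
  exists f : nat -> nat, (forall i j, i < j -> f i < f j) /\
    exists k, forall i j, i < j -> col (f i) (f j) = k.
Proof.
(* [r] consists of a point, a colour and the thinned set. For bounded [A], which the iteration never
   meets, any [r] will do. *)
pose next (A : nat -> Prop) (r : nat * K * (nat -> Prop)) :=
  unbounded A -> [/\ A r.1.1, unbounded r.2
    & forall x, r.2 x -> [/\ A x, r.1.1 < x & col r.1.1 x = r.1.2]].
have /choice[s sP] A : exists r, next A r.
  have [uA|nA] := pselect (unbounded A); last first.
    by exists (0, col 0 0, A) => /nA.
  have [a _ Aa] := uA 0.
  have uA' : unbounded (fun x => A x /\ a < x).
    move=> n; have [x] := uA (maxn n a.+1).
    by rewrite geq_max => /andP[nx ax] Ax; exists x.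
  have [k uk] := unbounded_pigeonhole (col a) uA'.
  by exists (a, k, fun x => (A x /\ a < x) /\ col a x = k) => _; split=> // x [[]].
pose S i := iter i (fun A => (s A).2) (fun=> True).
pose a i := (s (S i)).1.1; pose k i := (s (S i)).1.2.
have uS i : unbounded (S i).
  by elim: i => [n|i /sP[]//]; exists n.
have step i x : S i.+1 x -> [/\ S i x, a i < x & col (a i) x = k i].
  by have [_ _] := sP _ (uS i); apply.
have Sa i : S i (a i) by have [] := sP _ (uS i).
have mono i j x : i <= j -> S j x -> S i x.
  by move=> /subnK <-; elim: (j - i) => // l IH /step[/IH].
have col_a i j : i < j -> a i < a j /\ col (a i) (a j) = k i.
  by move=> ij; have [] := step i (a j) (mono _ _ _ ij (Sa j)).
have [k0 uk0] : exists k0, unbounded (fun i => True /\ k i = k0).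
  by apply: unbounded_pigeonhole => n; exists n.
have [f [f_mono fk]] := unbounded_enum uk0.
exists (a \o f); split=> [i j ij|]; first exact: (col_a _ _ (f_mono _ _ ij)).1.
by exists k0 => i j ij; rewrite /= (col_a _ _ (f_mono _ _ ij)).2 (fk i).2.
Qed.

(* u_i and v_i are chosen among the nodes w 0^l 1, where w is u_(i-1). *)
Lemma tree_indiscernible_pairs (K : finType) (col : seq bool -> seq bool -> K) :
  exists u v : nat -> seq bool,
    [/\ forall i j, i <= j -> prefix (u i) (u j),
        forall i, exists2 nu, v i = rcons nu true & prefix (rcons nu false) (u i),
        forall i, col (u i) (u i) = col (v i) (v i)
      & forall i j, i < j -> col (u i) (u j) = col (u i) (v j)].
Proof.
pose good (h : seq (seq bool)) (r : seq bool * seq bool) :=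
  [/\ prefix (head [::] h) r.1,
      exists2 nu, r.2 = rcons nu true & prefix (rcons nu false) r.1,
      col r.1 r.1 = col r.2 r.2
    & forall w, w \in h -> col w r.1 = col w r.2].
have /choice[s sP] h : exists r, good h r.
  pose e l := rcons (head [::] h ++ nseq l false) true.
  (* [chi l] is the colour of the candidate [e l] with itself together with its colours over all
     earlier nodes. *)
  pose chi l := (col (e l) (e l), map_tuple (fun w => col w (e l)) (in_tuple h)).
  have [l [k [lk _ [self [past]]]]] := pigeonhole chi.
  (* The longer node continues the branch: as [l < k], it has a 0 where [e l] has its final 1. *)
  exists (e k, e l); split=> //=.
  - by rewrite /e rcons_cat prefix_prefix.
  - exists (head [::] h ++ nseq l false) => //.
    have -> : k = l + (k - l.+1).+1 by rewrite -addSnnS subnKC.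
    apply/prefixP; exists (rcons (nseq (k - l.+1) false) true).
    by rewrite /e nseqD -!cats1 -!catA.
  - by move=> w wh; have /eq_in_map -> := past.
(* Earlier nodes are listed latest first, so the head is the previous node, or the root when there
   is none. *)
pose hist i := iter i (fun h => (s h).1 :: h) [::].
exists (fun i => (s (hist i)).1), (fun i => (s (hist i)).2); split.
- move=> i j /subnK <-; elim: (j - i) => [|l IH]; first exact: prefix_refl.
  by apply: prefix_trans IH _; have [] := sP (hist (l.+1 + i)).
- by move=> i; have [] := sP (hist i).
- by move=> i; have [] := sP (hist i).
- move=> i j ij; have [_ _ _] := sP (hist j); apply.
  by rewrite -(subnK ij); elim: (j - i.+1) => [|l IH]; rewrite inE ?eqxx // IH orbT.
Qed.

(* If d_i(t) or c_i(t) coincides with c_j(s) for one j > i, it does so for all of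
   them, so that c_j(s) does not depend on j and already occurs in c_0. *)
Lemma homogeneous_transfer C T (r : C -> C -> Prop) (c d : nat -> T -> C) :
  (forall x y, r x y -> r y x) -> (forall x y z, r x y -> r y z -> r x z) ->
  (forall i j k l s t, i < j -> k < l ->
     (r (c i s) (c j t) <-> r (c k s) (c l t)) /\
     (r (d i s) (c j t) <-> r (d k s) (c l t))) ->
  (forall i j s t, i < j -> r (c i s) (c j t) <-> r (c i s) (d j t)) ->
  forall i j s t, 0 < i -> i < j ->
    r (c j s) (d i t) <-> r (c j s) (c i t).
Proof.
move=> rsym rtrans hom cd i j s t i0 ij.
have jj := ltnSn j; have j0 := ltn_trans i0 ij; have ij' := ltn_trans ij jj.
split=> h.
- have h1 : r (d i t) (c j.+1 s) by apply/(hom i j.+1 i j t s ij' ij).2/rsym.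
  have h2 : r (c 0 s) (c j s).
    by apply/(hom 0 j j j.+1 s s j0 jj).1; exact: (rtrans _ _ _ h h1).
  apply: (rtrans _ _ _ (rsym _ _ h2)); apply/(cd 0 i) => //.
  exact: (rtrans _ _ _ h2 h).
- have h1 : r (c i t) (c j.+1 s) by apply/(hom i j.+1 i j t s ij' ij).1/rsym.
  have h2 : r (c 0 s) (c j s).
    by apply/(hom 0 j j j.+1 s s j0 jj).1; exact: (rtrans _ _ _ h h1).
  apply: (rtrans _ _ _ (rsym _ _ h2)); apply/(cd 0 i) => //.
  exact: (rtrans _ _ _ h2 h).
Qed.

(** * Realizing the formula over two tuples at once *)

Local Open Scope classical_set_scope.

(** These values make up the substructure generated by [c], the entry [c j] being the term at
    [(j, j)]. *)
Definition term C J (g : C -> C -> C) (c : J -> C) (s : J * J) : C :=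
  g (c s.1) (c s.2).

(** The conditions on terms say that fixing the terms of [c] and sending those of [d0] to those of
    [d] preserves equality and E, so the gluing applies. The condition on [b] ensures that whatever
    [b] shares with one of [c] and [d0] it shares with both, so that the copy of [b] respects F over
    each of them. *)
Lemma realize_both (T : theory Lfeq) (hT : model_completion Tfeq T)
    (C : structure Lfeq) E g (m : nat) (J : Type) (j0 : J)
    (b : 'I_m -> C) (c d0 d : J -> C) (phi : formula Lfeq ('I_m + J)) :
  models C T -> @presents C E g ->
  (forall s t, (term g d0 s = term g d0 t <-> term g d s = term g d t) /\
               (E (term g d0 s) (term g d0 t) <-> E (term g d s) (term g d t))) ->
  (forall s t, (term g c s = term g d t <-> term g c s = term g d0 t) /\
               (E (term g c s) (term g d t) <-> E (term g c s) (term g d0 t))) ->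
  (forall k, ((exists j, b k = c j) <-> (exists j, b k = d0 j)) /\
             ((exists j, E (b k) (c j)) <-> (exists j, E (b k) (d0 j)))) ->
  holds (join b c) phi -> holds (join b d0) phi ->
  exists x, holds (join x c) phi /\ holds (join x d) phi.
Proof.
move=> hC pC hd hcd hb bc bd0; have [ax _] := pC.
pose H y y' := exists s,
  (y = term g c s /\ y' = term g c s) \/ (y = term g d0 s /\ y' = term g d s).
have H_eq x x' y y' : H x x' -> H y y' -> x = y <-> x' = y'.
  case=> s [] [-> ->] [t [] [-> ->]] //.
  - by rewrite (hcd s t).1.
  - by split=> /esym; [move/(hcd t s).1|move/(hcd t s).1] => /esym.
  - exact: (hd s t).1.
have Esym x y : E x y <-> E y x by split; apply: (feq_sym ax).
have H_E x x' y y' : H x x' -> H y y' -> E x y <-> E x' y'.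
  case=> s [] [-> ->] [t [] [-> ->]] //.
  - by rewrite (hcd s t).2.
  - by rewrite Esym [E (term g d s) _]Esym (hcd t s).2.
  - exact: (hd s t).2.
have tdiag (e : J -> C) j : term g e (j, j) = e j by apply: (feq_diag ax).
have Hc j : H (c j) (c j) by exists (j, j); left; rewrite tdiag.
have Hd j : H (d0 j) (d j) by exists (j, j); right; rewrite !tdiag.
have [E' [g' [i [ax' lE lg [i_inj iE] [iH ig]]]]] := amalgam ax H_eq H_E.
set N := feq_structure (inhabits (inl (c j0) : C + C)%type) E' g'.
have pN : @presents N E' g' by apply: feq_structure_presents.
have lemb : @embedding _ C N inl.
  by apply: (feq_embedding pC pN) => // x y [].
have [subT extT elT] := hT.
(* The gluing is only a model of [Tfeq]; [T] speaks about an extension of it. *)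
have [N' [f [hN' femb]]] := extT N (models_feq_structure _ ax').
have [E1 [g1 pN']] := models_presents (subT _ hN').
have [f_inj fE fg] := embedding_feq pN pN' femb.
have transfer (e e' : J -> C) : (forall j, H (e j) (e' j)) ->
    (forall s, H (term g e s) (term g e' s)) ->
    (forall k, (exists p', H (b k) p') -> ~ E (b k) (b k) -> exists j, b k = e j) ->
    (forall k, (exists u v, H u v /\ E u (b k)) -> exists j, E (b k) (e j)) ->
    holds (join b e) phi -> holds (join (f \o i \o b) (f \o inl \o e')) phi.
  move=> He Ht bP bQ.
  have := holds_partial_iso hT (inr j0) (e := join b e) (f := f \o i) hC hN' pC pN'.
  have -> : (f \o i) \o join b e = join (f \o i \o b) (f \o inl \o e').
    by apply/funext => -[k|j] //=; rewrite (iH _ _ (He j)).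
  move=> iso; apply: (iso _ _ _ phi).1.
  - exact: inj_comp.
  - by move=> x y; rewrite /= fE.
  move=> x y /=; rewrite -fg; congr f.
  set y0 := join b e y; set x0 := join b e x.
  have [[Qx Py]|n] := pselect (E x0 x0 /\ ~ E y0 y0); last first.
    by rewrite (feq_out ax) // (feq_out ax') // !iE.
  apply: ig => hy hx.
  have [j yj] : exists j, y0 = e j.
    by case: (y) @y0 Py hy => [k|j] /= ? ?; [apply: bP|exists j].
  have [l xl] : exists l, E x0 (e l).
    by case: (x) @x0 Qx hx => [k|l] /= ? ?; [apply: bQ|exists l].
  exists (e l), (e' l), (e' j); rewrite yj; split=> //; first exact: (feq_sym ax).
  by rewrite (feq_class ax xl) -?yj //; have := Ht (l, j); rewrite /term /= yj.
(* The domain of [H] consists of terms while the condition on [b] is about entries. In P a term is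
   an entry, and every term related by E to [b k] has the class of an entry. *)
have P_term (e : J -> C) k s : b k = term g e s -> ~ E (b k) (b k) ->
    exists j, b k = e j.
  by move=> -> n; exists s.1; apply: (feq_P_term ax).
have E_term (e : J -> C) k s : E (term g e s) (b k) -> exists j, E (b k) (e j).
  by move=> /(feq_rep_iff ax) h; exists s.1; apply: (feq_sym ax).
have Hcs s : H (term g c s) (term g c s) by exists s; left.
have Hds s : H (term g d0 s) (term g d s) by exists s; right.
have {}bc := transfer c c Hc Hcs _ _ bc.
have {}bd0 := transfer d0 d Hd Hds _ _ bd0.
pose at_ (e : J -> C) (v : 'I_m + J) : 'I_m + C :=
  match v with inl k => inl k | inr j => inr (e j) end.
pose both := And (rename (at_ c) phi) (rename (at_ d) phi).
have bothE (M : structure Lfeq) (h : C -> M) (x : 'I_m -> M) :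
    holds (join x h) both <->
    holds (join x (h \o c)) phi /\ holds (join x (h \o d)) phi.
  have atE e : join x h \o at_ e = join x (h \o e) by apply/funext => -[].
  by rewrite /= and_encE !holds_rename !atE.
have [q qP] := ex_tuple_formula both.
have id_emb : @embedding _ C C id.
  by apply: (feq_embedding pC pC).
have flemb : @embedding _ C N' (f \o inl).
  apply: (feq_embedding pC pN') => [|x y|x z] /=; last by rewrite lg fg.
  - by apply: inj_comp => // x y [].
  - by rewrite fE.
have /qP[x /bothE xP] : holds (id : C -> C) q; last by exists x.
(* Both [C] and [N'] are models of [T] extending [C], so completeness over the diagram of [C] brings
   the tuple back to [C]. *)
apply/(elT _ _ _ (subT _ hC) hC hN' _ _ id_emb flemb)/qP.
exists (f \o i \o b); apply/bothE; split; [apply: bc|apply: bd0].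
- move=> k [p' [s [[bs _]|[bs _]]]] Pb; first exact: P_term bs Pb.
  by apply/(hb k).1; apply: P_term bs Pb.
- move=> k [u [v [[s [[-> _]|[-> _]]] h]]]; first exact: E_term h.
  by apply/(hb k).2; apply: E_term h.
- move=> k [p' [s [[bs _]|[bs _]]]] Pb; last exact: P_term bs Pb.
  by apply/(hb k).1; apply: P_term bs Pb.
- move=> k [u [v [[s [[-> _]|[-> _]]] h]]]; last exact: E_term h.
  by apply/(hb k).2; apply: E_term h.
Qed.

(** * From the tree to a contradiction *)

Lemma prefix_mkseq (u w : seq bool) : prefix u w ->
  mkseq (nth false w) (size u) = u.
Proof.
move=> /prefixP[s ->]; apply: (@eq_from_nth _ false); rewrite size_mkseq // => i iu.
by rewrite nth_mkseq // nth_cat iu.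
Qed.

Lemma holds_inst L (C : structure L) m n (phi : formula L ('I_m + 'I_n)) b
    (x : 'I_m -> C) :
  holds (join x id) (inst phi b) <-> holds (join x b) phi.
Proof.
by rewrite /inst holds_rename; split; apply: eq_holds => -[].
Qed.

Theorem theorem2p1 (T : theory Lfeq) (hT : model_completion Tfeq T) :
  ~ has_SOP1 T.
Proof.
move=> [K [C [[_ hC _ _] [m [n [phi [a [branch incons]]]]]]]].
have [subT _ _] := hT; have [E [g pC]] := models_presents (subT _ hC).
have [ax _] := pC.
(* For [n = 0] all parameters coincide, so the supposedly inconsistent pair is a single formula,
   which occurs on every branch. *)
have [s0] : inhabited 'I_n.
  case: n phi a branch incons => [|n] phi a branch incons; last exact: inhabits ord0.
  case: (incons [::] [:: false] isT) => q q_fin q_sub.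
  apply: (branch xpred0 q q_fin) => psi /q_sub psiE; exists 0 => //=.
  have aE eta : a eta = a [::] by apply/funext; case.
  by move: psiE; rewrite /= !aE => -[].
pose tm eta := term g (a eta).
(* The colour records equality and E between terms, hence F through the terms themselves. *)
pose col eta eta' := [ffun st : ('I_n * 'I_n) * ('I_n * 'I_n) =>
  (`[< tm eta st.1 = tm eta' st.2 >], `[< E (tm eta st.1) (tm eta' st.2) >])].
have colE e1 e2 e3 e4 s t : col e1 e2 = col e3 e4 ->
    (tm e1 s = tm e2 t <-> tm e3 s = tm e4 t) /\
    (E (tm e1 s) (tm e2 t) <-> E (tm e3 s) (tm e4 t)).
  move=> /ffunP/(_ (s, t)); rewrite !ffunE /= => -[eqc eqE].
  by split; split=> /asboolP; [rewrite eqc|rewrite -eqc|rewrite eqE|rewrite -eqE] => /asboolP.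
have [u [v [uu uv self past]]] := tree_indiscernible_pairs col.
have [f [f_mono [k0 fk]]] :=
  ramsey_pairs (fun i j => (col (u i) (u j), col (v i) (u j))).
pose c i := tm (u (f i)); pose d i := tm (v (f i)).
have hom i j k l s t : i < j -> k < l ->
    ((c i s = c j t <-> c k s = c l t) /\ (d i s = c j t <-> d k s = c l t)) /\
    ((E (c i s) (c j t) <-> E (c k s) (c l t)) /\
     (E (d i s) (c j t) <-> E (d k s) (c l t))).
  move=> ij kl; have := fk _ _ ij; rewrite -(fk _ _ kl) => -[h1 h2].
  by have [? ?] := colE _ _ _ _ s t h1; have [? ?] := colE _ _ _ _ s t h2.
have cd i j s t : i < j ->
    (c i s = c j t <-> c i s = d j t) /\ (E (c i s) (c j t) <-> E (c i s) (d j t)).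
  by move=> ij; apply: colE; apply: past; apply: f_mono.
have cross i j s t : 0 < i -> i < j ->
    (c j s = d i t <-> c j s = c i t) /\ (E (c j s) (d i t) <-> E (c j s) (c i t)).
  move=> i0 ij; split.
    apply: (homogeneous_transfer (r := eq)) i0 ij => //.
    - by move=> x y z -> ->.
    - by move=> *; apply: (hom _ _ _ _ _ _ _ _).1.
    - by move=> *; apply: (cd _ _ _ _ _).1.
  apply: (homogeneous_transfer (r := E)) i0 ij.
  - exact: (feq_sym ax).
  - exact: (feq_trans ax).
  - by move=> *; apply: (hom _ _ _ _ _ _ _ _).2.
  - by move=> *; apply: (cd _ _ _ _ _).2.
(* [N] counts the ways in which a tuple can meet [c_i]. The pigeonhole needs indices up to [N],
   which the shift in [meets] turns into [N.+1]. *)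
pose N := #|{: {ffun 'I_m -> bool * bool}}|.
pose w := u (f N.+1).
have [x xP] : exists x : 'I_m -> C, forall i, i <= N.+1 ->
    holds (join x (a (u (f i)))) phi.
  (* The branch is [w] continued by zeros; it passes through all the nodes considered, since [w] is
     the last of them. *)
  have [||x xP] := branch (nth false w) [set inst phi (a (u (f i))) | i in `I_N.+2].
  - by apply: finite_image; apply: finite_II.
  - move=> _ [i /= iN <-]; exists (size (u (f i))) => //.
    rewrite prefix_mkseq //; apply: uu.
    by move: iN; rewrite ltnS leq_eqVlt => /predU1P[->//|/f_mono/ltnW].
  - by exists x => i iN; apply/holds_inst; apply: xP; exists i.
(* The shift to [i.+1] keeps [c_0] free as the earlier tuple required by [cross]. *)
pose meets i := [ffun k : 'I_m => (`[< exists s, x k = a (u (f i.+1)) s >],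
                                   `[< exists s, E (x k) (a (u (f i.+1)) s) >])].
have [i [j [ij jN meetsE]]] := pigeonhole meets.
have mE k : ((exists s, x k = a (u (f j.+1)) s) <-> (exists s, x k = a (u (f i.+1)) s)) /\
    ((exists s, E (x k) (a (u (f j.+1)) s)) <-> (exists s, E (x k) (a (u (f i.+1)) s))).
  have /ffunP/(_ k) := meetsE; rewrite !ffunE => -[eqc eqE].
  by split; split=> /asboolP; [rewrite -eqc|rewrite eqc|rewrite -eqE|rewrite eqE] => /asboolP.
have ij1 : i.+1 < j.+1 by [].
(* Here [c] is [c_j], [d0] is [c_i] and [d] is [d_i], with both indices shifted by one. *)
have [y [yc yd]] := realize_both hT s0 hC pC (d := a (v (f i.+1)))
  (fun s t => colE _ _ _ _ s t (self _)) (fun s t => cross _ _ s t (ltn0Sn i) ij1)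
  mE (xP j.+1 jN) (xP i.+1 (leqW (leq_trans ij jN))).
(* The node of [d_i] is [nu] followed by 1, while the branch from [c_i] on, hence [c_j], passes
   through [nu] followed by 0. *)
have [nu vE nu_u] := uv (f i.+1).
apply: (incons nu (u (f j.+1))).
  by apply: prefix_trans nu_u _; apply: uu; apply: ltnW; apply: f_mono.
move=> q _ q_sub; exists y => psi /q_sub /= [->|->]; first exact/holds_inst.
by apply/holds_inst; rewrite -vE.
Qed.
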